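(* Let $G$ be the Galilean group acting on spacetime $\mathrm{ET}=\mathbf{R}^3\times\mathbf{R}$, and let $\mathrm{E}$ be a Euclidean affine space of dimension $3$ with its Euclidean group $\mathrm{Euc}(\mathrm{E})$ acting on it. There exists no submersion $\pi:\mathrm{ET}\to \mathrm{E}$ onto $\mathrm{E}$ that intertwines the actions of the Galilean group and the Euclidean group; that is, there is no pair $(\pi,h)$ consisting of a submersion $\pi$ from $\mathrm{ET}$ onto $\mathrm{E}$ and a map $h:G\to \mathrm{Euc}(\mathrm{E})$ such that $$\pi(g(x))=h(g)(\pi(x))\qquad\text{for all } g\in G,\ x\in \mathrm{ET}.$$
   Context: The Galilean group $G$ is the group of transformations $(r,t)\mapsto (Ar+Bt+C,\ t+e)$ of $\mathbf{R}^3\times\mathbf{R}$ with $A\in \mathrm{SO}(3)$, $B,C\in\mathbf{R}^3$, $e\in\mathbf{R}$ (the identity component convention). The Euclidean group $\mathrm{Euc}(\mathrm{E})$ is the group of isometries of $\mathrm{E}$. A submersion onto $\mathrm{E}$ is a smooth ($C^\infty$) surjective map whose tangent linear map is surjective at every point. *)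

(* Defs.v *)
From HB Require Import structures.
From mathcomp Require Import all_boot all_order all_algebra.
From mathcomp Require Import all_classical all_reals all_analysis.
Set Implicit Arguments.
Unset Strict Implicit.
Unset Printing Implicit Defensive.
Import Order.TTheory GRing.Theory Num.Theory.
Import numFieldNormedType.Exports.
Local Open Scope ring_scope.

(* Continuity of each [fun x => 'd f x v] is continuity of [x |-> 'd f x] in
   operator norm only when [V] is finite-dimensional, so these are the usual
   C^k and C^oo classes only for such [V]. *)
Fixpoint is_Ck (R : realType) (V W : normedModType R) (k : nat) (f : V -> W)
    : Prop :=
  if k is k'.+1 then
    (forall x, differentiable f x) /\
    (forall v, is_Ck k' (fun x => 'd f x v))
  else continuous f.

Definition smooth (R : realType) (V W : normedModType R) (f : V -> W) : Prop :=
  forall k, is_Ck k f.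

(* Spacetime carries the library's norm, which is not Euclidean; only the
   differentiable structure it induces is used. *)
Definition spacetime (R : realType) : normedModType R := ('cV[R]_3 * R)%type.

Definition SO3 (R : realType) (A : 'M[R]_3) : Prop :=
  A^T *m A = 1%:M /\ \det A = 1.

Definition galilean_map (R : realType) (A : 'M[R]_3) (B C : 'cV[R]_3) (e : R)
    (x : spacetime R) : spacetime R :=
  (A *m x.1 + x.2 *: B + C, x.2 + e).

Record galilean_group (R : realType) := GalileanGroup {
  galilean_fun :> spacetime R -> spacetime R;
  galilean_funP : exists A B C e, SO3 A /\ galilean_fun = galilean_map A B C e
}.

(* [vec p q] is the vector from [p] to [q].  [Vector.axiom n direction] is the
   type of linear bijections from [direction] onto ['rV_n]. *)
Record euclidean_affine_space (R : realType) (n : nat) := EuclideanAffineSpace {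
  point :> Type;
  direction : normedModType R;
  inner : {dot direction for (idfun : R -> R)};
  norm_inner : forall v : direction, `|v| = Num.sqrt (inner v v);
  direction_dim : inhabited (Vector.axiom n direction);
  vec : point -> point -> direction;
  vec_chasles : forall p q r, vec p q + vec q r = vec p r;
  vec_bij : forall p, bijective (vec p);
  point_inhabited : inhabited point
}.

Definition edist (R : realType) (n : nat) (E : euclidean_affine_space R n)
    (p q : E) : R := `|vec p q|.

Record euclidean_group (R : realType) (n : nat)
    (E : euclidean_affine_space R n) := EuclideanGroup {
  euclidean_fun :> E -> E;
  euclidean_fun_bij : bijective euclidean_fun;
  euclidean_fun_isom : forall p q,
    edist (euclidean_fun p) (euclidean_fun q) = edist p q
}.

Definition smooth_to (R : realType) (V : normedModType R) (n : nat)
    (E : euclidean_affine_space R n) (f : V -> E) : Prop :=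
  forall o : E, smooth (fun x => vec o (f x)).

(* The tangent spaces of [E] are identified with its direction. *)
Definition tangent_map (R : realType) (V : normedModType R) (n : nat)
    (E : euclidean_affine_space R n) (f : V -> E) (x : V)
    : V -> direction E :=
  'd (fun y => vec (f x) (f y)) x.

Definition submersion_onto (R : realType) (V : normedModType R) (n : nat)
    (E : euclidean_affine_space R n) (f : V -> E) : Prop :=
  [/\ smooth_to f,
      (forall p : E, exists x, f x = p) &
      (forall x v, exists w, tangent_map f x w = v)].

(* Main.v *)
Require Import Defs.
From mathcomp Require Import all_boot all_order all_algebra.
From mathcomp Require Import all_classical all_reals all_analysis.
Set Implicit Arguments.
Unset Strict Implicit.
Unset Printing Implicit Defensive.
Import Order.TTheory GRing.Theory Num.Theory.
Import numFieldNormedType.Exports.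
Local Open Scope classical_set_scope.
Local Open Scope ring_scope.

(** For every [t != 0] the boost [(s, u) |-> (s - u / t *: r + r, u)] sends the
    origin to [(r, 0)] and fixes [(0, t)].  As [h g] is an isometry, [pi (r, 0)]
    and [pi (0, 0)] are equidistant from [pi (0, t)]; letting [t] tend to [0],
    they coincide.  So [pi] is constant on the slice [t = 0], its tangent map at
    the origin kills the three spatial directions and has rank at most [1]. *)

Lemma SO3_1 (R : realType) : SO3 (1%:M : 'M[R]_3).
Proof. by split; [rewrite trmx1 mul1mx | rewrite det1]. Qed.

Definition boost (R : realType) (B C : 'cV[R]_3) : galilean_group R :=
  GalileanGroup
    (ex_intro _ 1%:M (ex_intro _ B (ex_intro _ C (ex_intro _ 0
      (conj (SO3_1 R) erefl))))).

Lemma boostE (R : realType) (B C r : 'cV[R]_3) (t : R) :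
  boost B C (r, t) = (r + t *: B + C, t).
Proof. by rewrite /= /galilean_map /= mul1mx addr0. Qed.

Section AffineSpace.
Variables (R : realType) (n : nat) (E : euclidean_affine_space R n).
Implicit Types p q r : E.

Lemma vecpp p : vec p p = 0.
Proof. by apply: (addrI (vec p p)); rewrite vec_chasles addr0. Qed.

Lemma vecC p q : vec p q = - vec q p.
Proof. by apply/eqP; rewrite -addr_eq0 vec_chasles vecpp. Qed.

Lemma edistC p q : Defs.edist p q = Defs.edist q p.
Proof. by rewrite /Defs.edist vecC normrN. Qed.

Lemma edist_triangle p q r : Defs.edist p r <= Defs.edist p q + Defs.edist q r.
Proof. by rewrite /Defs.edist -(vec_chasles p q r) ler_normD. Qed.

End AffineSpace.

(** In the coordinates given by [direction_dim], the first two basis vectors would both be multiples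
    of the single row [f c]. *)
Lemma line_not_onto (R : realType) n (E : euclidean_affine_space R n)
    (c : direction E) :
  (1 < n)%N -> ~ (forall v, exists t : R, v = t *: c).
Proof.
move=> n1 onto; have [[f flin [g fK gK]]] := direction_dim E.
pose i := Ordinal (ltnW n1); pose j := Ordinal n1.
have coord k : exists t : R, delta_mx 0 k = t *: f c.
  have [t gt] := onto (g (delta_mx 0 k)); exists t.
  by rewrite -[LHS]gK gt (scalable_linear flin).
have [t ti] := coord i; have [s sj] := coord j.
have entry k l u : delta_mx 0 k = u *: f c -> (l == k)%:R = u * f c 0 l.
  by move=> /matrixP/(_ 0 l); rewrite !mxE eqxx.
have fci : f c 0 i != 0.
  by apply: contra_eq_neq (entry _ i _ ti) => ->; rewrite mulr0 eqxx oner_eq0.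
(* Entry [i] of the basis vector at [j] is zero while [f c 0 i] is not, so the factor [s] vanishes,
   and with it the entry [j], which should be one. *)
have /eqP := entry _ i _ sj; rewrite eq_sym mulf_eq0 (negPf fci) orbF => /eqP s0.
by have /eqP := entry _ j _ sj; rewrite s0 mul0r eqxx oner_eq0.
Qed.

Section EquivariantMap.
Variables (R : realType) (n : nat) (E : euclidean_affine_space R n).
Variables (pi : spacetime R -> E) (h : galilean_group R -> euclidean_group E).
Hypothesis pi_equivariant : forall (g : galilean_group R) x, pi (g x) = h g (pi x).

Lemma edist_equivariant (g : galilean_group R) x y :
  Defs.edist (pi (g x)) (pi (g y)) = Defs.edist (pi x) (pi y).
Proof. by rewrite !pi_equivariant euclidean_fun_isom. Qed.

Lemma edist_slice (r : 'cV[R]_3) (t : R) : t != 0 ->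
  Defs.edist (pi (r, 0)) (pi (0, t)) = Defs.edist (pi (0, 0)) (pi (0, t)).
Proof.
move=> t0; rewrite -(edist_equivariant (boost (- t^-1 *: r) r) (0, 0) (0, t)) !boostE.
by rewrite scale0r !add0r scalerA mulrN mulfV// scaleN1r addNr.
Qed.

Lemma slice_constant (r : 'cV[R]_3) :
  {for (0, 0), continuous (fun x => vec (pi (0, 0)) (pi x))} ->
  vec (pi (0, 0)) (pi (r, 0)) = 0.
Proof.
move=> pic; apply/normr0_eq0/le_anti; rewrite normr_ge0 andbT.
(* Triangle inequality through [pi (0, t)], whose two legs have equal length; the left side does not
   depend on [t]. *)
have dist_t (t : R) : t != 0 -> `|vec (pi (0, 0)) (pi (r, 0))| <=
    `|vec (pi (0, 0)) (pi (0, t))| *+ 2.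
  move=> t0; apply: le_trans (edist_triangle _ (pi (0, t)) _) _.
  by rewrite mulr2n lerD2l [leLHS]edistC edist_slice.
apply/ler_addgt0Pl => e e0; rewrite addr0.
(* The limit is taken over punctured neighbourhoods because [dist_t] requires [t != 0]. *)
have ct :
    (fun t : R => vec (pi (0, 0)) (pi (0, t))) @ 0^' --> (0 : direction E).
  rewrite -[X in _ --> X](vecpp (pi (0, 0))).
  apply: cvg_within_filter.
  apply: (@continuous_comp _ _ _ (fun t : R => (0, t) : spacetime R)
     (fun x => vec (pi (0, 0)) (pi x)) 0 _ pic).
  have c0 :
      (fun t : R => (0 : 'cV[R]_3, t)) @ (0 : R) --> (0 : 'cV[R]_3, 0 : R).
    exact: (cvg_pair (cvg_cst _) (@cvg_id _ _)).
  exact: c0.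
have /cvgr0Pnorm_lt/(_ (e / 2)) := ct.
rewrite divr_gt0// => /(_ isT) nt.
near (0 : R)^' => t.
apply: le_trans (dist_t t _) _; first by near: t; exact: nbhs_dnbhs_neq.
rewrite -mulr_natr -ler_pdivlMr//; apply: ltW; near: t; exact: nt.
Unshelve. all: by end_near. Qed.

Lemma tangent_map_slice (r : 'cV[R]_3) :
  differentiable (fun x => vec (pi (0, 0)) (pi x)) (0, 0) ->
  tangent_map pi (0, 0) (r, 0) = 0.
Proof.
move=> dpi; rewrite /tangent_map -deriveE// /derive.
(* The points [t *: (r, 0)] stay in the slice, so the difference quotient is identically zero. *)
apply: lim_near_cst => //; near=> t.
rewrite /= vecpp subr0.
have -> : t *: ((r, 0) : spacetime R) + (0, 0) = (t *: r, 0).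
  by congr pair; rewrite /= ?addr0 ?scaler0.
by rewrite slice_constant ?scaler0//; exact: differentiable_continuous.
Unshelve. all: by end_near. Qed.

End EquivariantMap.

Theorem mainTheorem4 (R : realType) (E : euclidean_affine_space R 3) :
  ~ exists (pi : spacetime R -> E) (h : galilean_group R -> euclidean_group E),
      submersion_onto pi /\
      forall (g : galilean_group R) (x : spacetime R),
        pi (g x) = h g (pi x).
Proof.
case=> pi [h [[smooth_pi _ onto] equiv]].
have [dpi _] := smooth_pi (pi (0, 0)) 1%N.
have {}dpi := dpi (0, 0).
(* Once the spatial directions are killed, the image of the tangent map is spanned by that of the
   time direction [(0, 1)], which contradicts surjectivity in dimension 3. *)
apply: (@line_not_onto _ _ E (tangent_map pi (0, 0) (0, 1))) => // v.
have [[r t] <-] := onto (0, 0) v; exists t.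
have -> : ((r, t) : spacetime R) = (r, 0) + t *: (0, 1).
  by congr pair; rewrite /= ?scaler0 ?addr0 ?add0r ?[_ *: _]mulr1.
rewrite {1}/tangent_map linearD linearZ /=.
by rewrite -/(tangent_map _ _ (r, 0)) (tangent_map_slice equiv)// add0r.
Qed.
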